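(* Let $X$ be the generic symmetric $n\times n$ matrix. For each symmetric $6\times6$ submatrix, with rows and columns $1\le i_1<\dots<i_6\le n$, put $z_{ab}=y_{i_ai_b}$. Then the following five cubic forms are minimal generators of degree three of the apolar ideal $\mathrm{Ann}(\mathrm{perm}(X))$ (i.e. they are part of a minimal homogeneous generating set of this ideal): $$F_1=z_{15}z_{24}z_{36}-z_{14}z_{25}z_{36}-z_{15}z_{23}z_{46}+z_{13}z_{25}z_{46}+z_{14}z_{23}z_{56}-z_{13}z_{24}z_{56},$$ $$F_2=z_{14}z_{26}z_{35}-z_{14}z_{25}z_{36}-z_{13}z_{26}z_{45}+z_{12}z_{36}z_{45}+z_{13}z_{25}z_{46}-z_{12}z_{35}z_{46},$$ $$F_3=z_{16}z_{24}z_{35}-z_{14}z_{25}z_{36}-z_{16}z_{23}z_{45}+z_{12}z_{36}z_{45}+z_{13}z_{25}z_{46}-z_{12}z_{35}z_{46}+z_{14}z_{23}z_{56}-z_{13}z_{24}z_{56},$$ $$F_4=z_{15}z_{26}z_{34}-z_{14}z_{25}z_{36}-z_{13}z_{26}z_{45}+z_{12}z_{36}z_{45}-z_{15}z_{23}z_{46}+z_{13}z_{25}z_{46}+z_{14}z_{23}z_{56}-z_{12}z_{34}z_{56},$$ $$F_5=z_{16}z_{25}z_{34}-z_{14}z_{25}z_{36}-z_{16}z_{23}z_{45}+z_{12}z_{36}z_{45}+z_{14}z_{23}z_{56}-z_{12}z_{34}z_{56}.$$ The $5\binom n6$ polynomials so obtained annihilate $\mathrm{perm}(X)$.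
   Context: Let $\mathsf k$ be an infinite field of characteristic zero or characteristic $p>2$. $X=(x_{ij})$ is the generic symmetric $n\times n$ matrix: its entries $x_{ij}=x_{ji}$, $1\le i\le j\le n$, are $n(n+1)/2$ distinct variables; $\mathrm{perm}(X)$ is its permanent. $R=\mathsf k[x_{ij}: i\le j]$ and $S=\mathsf k[y_{ij}: i\le j]$, with $y_{ij}=y_{ji}$. $S$ acts on $R$ by differentiation: $y_{ij}$ acts as $\partial/\partial x_{ij}$, and the action of $h\in S$ on $F\in R$ is written $h\circ F$; $h$ annihilates $F$ if $h\circ F=0$. $\mathrm{Ann}(F)=\{h\in S: h\circ F=0\}$. *)

(* Defs.v *)
From mathcomp Require Import all_boot all_order all_fingroup all_algebra.
From mathcomp Require Export mpoly.

Set Implicit Arguments.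
Unset Strict Implicit.
Unset Printing Implicit Defensive.

Import GRing.Theory.
Local Open Scope ring_scope.

Definition infinite_field (k : fieldType) : Prop :=
  ~ exists s : seq k, forall x : k, x \in s.

(* The indices of the n(n+1)/2 variables: unordered pairs, as pairs i <= j. *)
Notation symidx n := {ij : 'I_n * 'I_n | (ij.1 <= ij.2)%N}.

Definition sort2 (n : nat) (i j : 'I_n) : 'I_n * 'I_n :=
  if (i <= j)%N then (i, j) else (j, i).

Lemma sort2P (n : nat) (i j : 'I_n) : ((sort2 i j).1 <= (sort2 i j).2)%N.
Proof. by rewrite /sort2; case: (leqP i j) => [//|/ltnW]. Qed.

Definition sidx (n : nat) (i j : 'I_n) : symidx n :=
  exist (fun ij : 'I_n * 'I_n => (ij.1 <= ij.2)%N) (sort2 i j) (sort2P i j).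

Definition nvar (n : nat) : nat := #|{: symidx n}|.

(* R = k[x_ij] and S = k[y_ij] are both represented by this ring, with
   x_ij and y_ij both the variable [symvar k i j]. *)
Notation sympoly k n := {mpoly k[nvar n]}.

Definition symvar (k : fieldType) (n : nat) (i j : 'I_n) : sympoly k n :=
  'X_(enum_rank (sidx i j)).

Lemma symvarC (k : fieldType) (n : nat) (i j : 'I_n) :
  symvar k i j = symvar k j i.
Proof.
congr ('X_(enum_rank _)); apply: val_inj; rewrite /= /sort2.
by case: (ltngtP i j) => // /val_inj ->.
Qed.

Definition generic_symmx (k : fieldType) (n : nat) : 'M[sympoly k n]_n :=
  \matrix_(i, j) symvar k i j.

Definition permanent (A : comNzRingType) (n : nat) (M : 'M[A]_n) : A :=
  \sum_(s : 'S_n) \prod_(i < n) M i (s i).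

(* The action h o F by differentiation: the monomial y^m acts as the iterated
   partial derivative (not divided by factorials). *)
Definition diff_act (k : fieldType) (N : nat) (h F : {mpoly k[N]}) :
    {mpoly k[N]} :=
  \sum_(m <- msupp h) h@_m *: F^`M[m].

Definition Ann (k : fieldType) (N : nat) (F : {mpoly k[N]}) :
    pred {mpoly k[N]} :=
  [pred h | diff_act h F == 0].

Definition in_ideal (A : comNzRingType) (G : seq A) (h : A) : Prop :=
  exists c : 'I_(size G) -> A, h = \sum_(i < size G) c i * G`_i.

Definition generates (A : comNzRingType) (I : pred A) (G : seq A) : Prop :=
  forall h : A, h \in I <-> in_ideal G h.

Definition minimal_homog_generators (k : fieldType) (N : nat)
    (I : pred {mpoly k[N]}) (G : seq {mpoly k[N]}) : Prop :=
  [/\ uniq G,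
      forall g, g \in G -> exists d : nat, g \is d.-homog,
      generates I G
    & forall G' : seq {mpoly k[N]},
        {subset G' <= G} -> generates I G' -> {subset G <= G'}].

(* The choices i_1 < ... < i_6 of rows and columns. *)
Definition incr6 (n : nat) : {set {ffun 'I_6 -> 'I_n}} :=
  [set i : {ffun 'I_6 -> 'I_n} |
    [forall a : 'I_6, forall b : 'I_6, (a < b)%N ==> (i a < i b)%N]].

(* z_ab = y_{i_a i_b}, with a and b numbered from 1 to 6. *)
Definition zvar (k : fieldType) (n : nat) (i : {ffun 'I_6 -> 'I_n})
    (a b : nat) : sympoly k n :=
  symvar k (i (inord a.-1)) (i (inord b.-1)).

Definition five_cubics (k : fieldType) (n : nat) (i : {ffun 'I_6 -> 'I_n}) :
    seq (sympoly k n) :=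
  let z := zvar k i in
  [:: z 1 5 * z 2 4 * z 3 6 - z 1 4 * z 2 5 * z 3 6 - z 1 5 * z 2 3 * z 4 6
      + z 1 3 * z 2 5 * z 4 6 + z 1 4 * z 2 3 * z 5 6 - z 1 3 * z 2 4 * z 5 6;
      z 1 4 * z 2 6 * z 3 5 - z 1 4 * z 2 5 * z 3 6 - z 1 3 * z 2 6 * z 4 5
      + z 1 2 * z 3 6 * z 4 5 + z 1 3 * z 2 5 * z 4 6 - z 1 2 * z 3 5 * z 4 6;
      z 1 6 * z 2 4 * z 3 5 - z 1 4 * z 2 5 * z 3 6 - z 1 6 * z 2 3 * z 4 5
      + z 1 2 * z 3 6 * z 4 5 + z 1 3 * z 2 5 * z 4 6 - z 1 2 * z 3 5 * z 4 6
      + z 1 4 * z 2 3 * z 5 6 - z 1 3 * z 2 4 * z 5 6;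
      z 1 5 * z 2 6 * z 3 4 - z 1 4 * z 2 5 * z 3 6 - z 1 3 * z 2 6 * z 4 5
      + z 1 2 * z 3 6 * z 4 5 - z 1 5 * z 2 3 * z 4 6 + z 1 3 * z 2 5 * z 4 6
      + z 1 4 * z 2 3 * z 5 6 - z 1 2 * z 3 4 * z 5 6;
      z 1 6 * z 2 5 * z 3 4 - z 1 4 * z 2 5 * z 3 6 - z 1 6 * z 2 3 * z 4 5
      + z 1 2 * z 3 6 * z 4 5 + z 1 4 * z 2 3 * z 5 6 - z 1 2 * z 3 4 * z 5 6].

Definition all_cubics (k : fieldType) (n : nat) : seq (sympoly k n) :=
  [seq F | i <- enum (incr6 n), F <- five_cubics k i].

(* Main.v *)
Require Import Defs.
From HB Require Import structures.
From mathcomp Require Import all_boot all_order all_fingroup all_algebra.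
From mathcomp Require Import ssrcomplements bigenough ring.
From Stdlib Require Import Classical.

(** Annihilation. Let [mu] be a set of disjoint edges [ab] on the index set, and
    consider the product of the derivations [y_ab] over the edges of [mu].
    Since [x_ab] stands at the positions [(a, b)] and [(b, a)], this product
    sends the permanent to a sum over the orientations of [mu]: each
    orientation contributes the permanent of the matrix with the tails deleted
    from the rows and the heads deleted from the columns ([matching_action]).
    Such a minor depends only on the set of tails and the set of heads. Hence a
    perfect matching of six indices acts as a sum over the 3-subsets that meet
    each of its edges once ([matching_action_splits]), and a combination of
    matchings annihilates the permanent as soon as, for each 3-subset, the
    signs of the matchings that it meets in this way add up to zero. For the
    five cubics that is a finite verification over the integers
    ([cubic_table_balanced]), valid in every characteristic.

    Minimality. Two facts are used.
    - Each cubic contains a monomial that occurs in no other one, whatever the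
      choices of rows and columns ([mcoeff_cubic_lead]).
    - A proper divisor of such a monomial occurs in no element of the apolar
      ideal ([Ann_coef_below_matching]). Indeed, if [a, b, c, d] are distinct,
      then [y_ab y_cd], together with the diagonal derivations of all other
      indices, sends the permanent to
      [4 x_ab x_cd + 2 x_ac x_bd + 2 x_ad x_bc]. The three forms obtained by
      permuting the letters span the three products, because 2 is invertible.
      Thus [x_ab x_cd] is a combination of derivatives of the permanent and is
      annihilated by the whole apolar ideal ([Ann_kills_quadric]).
    Together they say that the cubics are linearly independent modulo the
    products of the variables with the elements of lower degree of the ideal.
    As in the graded form of the lemma of Nakayama, independent forms of this
    kind extend to a minimal system of homogeneous generators
    ([extend_to_minimal_generators]). A finite system of homogeneous generators
    to start from exists because the ideal contains all monomials of degree
    above [n] ([Ann_homog_finitely_generated]). *)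

Set Implicit Arguments.
Unset Strict Implicit.
Unset Printing Implicit Defensive.

Import GRing.Theory BigEnough.
Local Open Scope ring_scope.

(** * Extending forms to a minimal system of homogeneous generators *)

Lemma ex_minimizer (T : Type) (P : T -> Prop) (f : T -> nat) x : P x ->
  exists2 y, P y & forall z, P z -> (f y <= f z)%N.
Proof.
elim/ltn_ind: {x}(f x) {-2}x (erefl (f x)) => s IH x fx Px.
have [[z Pz lt]|H] := classic (exists2 z, P z & (f z < s)%N).
  exact: IH lt _ erefl Pz.
exists x => // z Pz; rewrite fx leqNgt; apply/negP => lt; apply: H.
by exists z.
Qed.

Section Ideals.
Variable A : comNzRingType.
Implicit Types (G : seq A) (h : A).

(** Indexing the coefficients by the generators themselves, instead of by their
    positions, lets a generator be singled out or removed inside the sum. *)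
Lemma in_idealP G h : uniq G ->
  in_ideal G h <-> exists c : A -> A, h = \sum_(g <- G) c g * g.
Proof.
move=> uG; split=> [[c ->]|[c ->]]; last first.
  exists (fun i => c G`_i).
  by rewrite (big_nth 0) big_mkord.
have [G0|G0] := posnP (size G).
  exists (fun=> 0); rewrite [RHS]big1 ?big1 // => [i _|g _]; last exact: mul0r.
  by have := ltn_ord i; rewrite {2}G0.
exists (fun g => c (insubd (Ordinal G0) (index g G))).
rewrite (big_nth 0) big_mkord; apply: eq_bigr => i _; congr (c _ * _).
by apply: val_inj; rewrite val_insubd index_uniq // ltn_ord.
Qed.

Lemma in_ideal0 G : in_ideal G 0.
Proof. by exists (fun=> 0); rewrite big1 // => i _; rewrite mul0r. Qed.

Lemma in_idealD G h h' : in_ideal G h -> in_ideal G h' -> in_ideal G (h + h').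
Proof.
move=> [c ->] [c' ->]; exists (fun i => c i + c' i).
by rewrite -big_split; apply: eq_bigr => i _; rewrite mulrDl.
Qed.

Lemma in_idealM G c h : in_ideal G h -> in_ideal G (c * h).
Proof.
move=> [d ->]; exists (fun i => c * d i).
by rewrite mulr_sumr; apply: eq_bigr => i _; rewrite mulrA.
Qed.

Lemma in_ideal_sum (J : Type) (r : seq J) (P : pred J) (F : J -> A) G :
  (forall j, P j -> in_ideal G (F j)) -> in_ideal G (\sum_(j <- r | P j) F j).
Proof.
by move=> H; elim/big_ind: _ => //; [apply: in_ideal0 | apply: in_idealD].
Qed.

Lemma mem_in_ideal G g : g \in G -> in_ideal G g.
Proof.
move=> gG; have lt : (index g G < size G)%N by rewrite index_mem.
exists (fun i => (i == Ordinal lt)%:R).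
rewrite (bigD1 (Ordinal lt)) //= eqxx mul1r nth_index // big1 ?addr0 // => i.
by move/negbTE ->; rewrite mul0r.
Qed.

Lemma in_ideal_trans G G' h :
  (forall g, g \in G -> in_ideal G' g) -> in_ideal G h -> in_ideal G' h.
Proof.
move=> H [c ->]; apply: in_ideal_sum => i _; apply: in_idealM.
by apply: H; apply: mem_nth.
Qed.

End Ideals.

Section Graded.
Variables (k : fieldType) (N : nat).
Implicit Types (p q h F c : {mpoly k[N]}) (m : 'X_{1..N}).

Lemma mcoeff_pihomog d p m :
  (pihomog mdeg d p)@_m = if mdeg m == d then p@_m else 0.
Proof.
case: eqP => [eqd|/eqP ned]; last exact: dhomog_nemf_coeff (pihomogP _ _ _) ned.
rewrite {2}[p]mpolyE pihomogE !raddf_sum /= big_mkcond /=.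
apply: eq_bigr => m' _; case: ifP => // neq; rewrite mcoeffZ mcoeffX.
by have [e|_] := eqVneq m' m; [rewrite e eqd eqxx in neq | rewrite mulr0].
Qed.

(** Multiplying by a form of degree [e] shifts degrees by [e], so the part of
    degree [d] of a multiple of [g] is again a multiple of [g]; this is what
    allows a relation among homogeneous generators to be cut down to one degree. *)
Lemma pihomogM d e c g : g \is e.-homog ->
  pihomog mdeg d (c * g) =
  (if (e <= d)%N then pihomog mdeg (d - e) c else 0) * g.
Proof.
move=> hg; rewrite {1}[c]mpolyE mulr_suml raddf_sum /=.
have -> : (if (e <= d)%N then pihomog mdeg (d - e) c else 0) =
    \sum_(m <- msupp c) if (mdeg m + e == d)%N then c@_m *: 'X_[m] else 0.
  case: leqP => led; last first.
    rewrite big1 // => m _; case: eqP => // eqd.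
    by move: led; rewrite -eqd ltnNge leq_addl.
  rewrite pihomogE big_mkcond /=; apply: eq_bigr => m _.
  by rewrite -(eqn_add2r e) subnK.
rewrite mulr_suml; apply: eq_bigr => m _.
have hm : (c@_m *: 'X_[m]) * g \is (mdeg m + e).-homog.
  by rewrite -scalerAl; apply: dhomogZ; apply: dhomogM => //; rewrite dhomogX.
case: eqP => [<-|/eqP ne]; first by rewrite pihomog_dE.
by rewrite (pihomog_ne0 ne hm) mul0r.
Qed.

Lemma pihomog0E c : pihomog mdeg 0 c = (c@_0%MM)%:MP.
Proof.
apply/mpolyP => m; rewrite mcoeff_pihomog mcoeffC mdeg_eq0.
by have [->|_] := eqVneq m 0%MM; rewrite ?mulr1 ?mulr0.
Qed.

(** If [g] involves no proper divisor of [m], a term of [c] of positive degree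
    can only produce [m] out of a proper divisor of [m] in [g]. *)
Lemma mcoeffM_minimal c g m :
  (forall m', (m' <= m)%MM -> m' != m -> g@_m' = 0) ->
  (c * g)@_m = c@_0%MM * g@_m.
Proof.
move=> g0; rewrite [c]mpolyE mulr_suml raddf_sum /= raddf_sum /= mulr_suml.
apply: eq_bigr => a _; rewrite -scalerAl !mcoeffZ -mulrA; congr (_ * _).
rewrite mcoeffX.
have [->|a0] := eqVneq a 0%MM; first by rewrite mpolyX0 !mul1r.
rewrite mul0r.
have [leam|nleam] := boolP (a <= m)%MM.
  rewrite mulrC -{1}(submK leam) addmC mcoeffMX g0 ?lem_subr //.
  apply: contraNneq a0 => e; apply/eqP/mnmP => i.
  have := congr1 (fun x : 'X_{1..N} => x i) (submK leam).
  by rewrite e mnmDE mnm0E -[RHS]addn0 => /addnI.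
rewrite mcoeffM big1 // => -[u v] /= /eqP e; rewrite mcoeffX.
case: eqP => [ea|]; last by rewrite mul0r.
by case/negP: nleam; rewrite e ea lem_addr.
Qed.

(** [privateL] is the criterion that makes the forms in [L] independent modulo
    the products of the ideal with the variables: each has a monomial of its
    own, none of whose proper divisors occurs in the ideal. *)
Section Extend.
Variables (I : pred {mpoly k[N]}) (G0 L : seq {mpoly k[N]}).
Hypothesis genG0 : generates I G0.
Hypothesis homG0 : forall g, g \in G0 -> exists d : nat, g \is d.-homog.
Hypothesis homL : forall F, F \in L -> exists d : nat, F \is d.-homog.
Hypothesis subL : forall F, F \in L -> F \in I.
Hypothesis privateL : forall F, F \in L -> exists m, [/\ F@_m != 0,
  forall F', F' \in L -> F' != F -> F'@_m = 0
  & forall h m', h \in I -> (m' <= m)%MM -> m' != m -> h@_m' = 0].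

Let good G := [/\ uniq G, forall g, g \in G -> exists d : nat, g \is d.-homog,
  generates I G & {subset L <= G}].

(** A generator outside [L] that the others generate can be dropped; a shortest
    [good] list therefore has none. *)
Lemma good_rem G g : good G -> g \notin L -> in_ideal (rem g G) g ->
  good (rem g G).
Proof.
move=> [uG homG genG LG] gL gin; split=> [||h|F FL].
- exact: rem_uniq.
- by move=> g' /mem_rem; apply: homG.
- rewrite genG; split; apply: in_ideal_trans => g' g'G.
    have [->//|ne] := eqVneq g' g; apply: mem_in_ideal.
    by rewrite mem_rem_uniq // inE ne.
  by apply: mem_in_ideal; apply: mem_rem g'G.
- rewrite mem_rem_uniq // inE LG // andbT.
  by apply: contraNneq gL => <-.
Qed.

(** Take a shortest homogeneous generating list [G] that contains [L]. If some
    [F] in [L] were a combination of the others, then at the private monomial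
    of [F] only the constant terms of the coefficients would be seen, so one of
    them is nonzero at a generator [g] which involves that monomial: [g] has the
    degree of [F] and is not in [L]. In that degree the relation can be solved
    for [g], which contradicts the choice of [G]. *)
Lemma extend_to_minimal_generators :
  exists2 G, minimal_homog_generators I G & {subset L <= G}.
Proof.
have good0 : good (undup (L ++ G0)).
  split=> [||h|F FL].
  - exact: undup_uniq.
  - by move=> g; rewrite mem_undup mem_cat => /orP[/homL|/homG0].
  - split=> [hI|].
      apply: in_ideal_trans (proj1 (genG0 h) hI) => g gG0.
      by apply: mem_in_ideal; rewrite mem_undup mem_cat gG0 orbT.
    move=> hin; apply/genG0; apply: in_ideal_trans hin => g.
    by rewrite mem_undup mem_cat => /orP[/subL/genG0//|/mem_in_ideal].
  - by rewrite mem_undup mem_cat FL.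
have [G gG minG] := ex_minimizer size good0.
have irr g : g \in G -> g \notin L -> ~ in_ideal (rem g G) g.
  move=> gin gL gid; have := minG _ (good_rem gG gL gid).
  by rewrite size_rem // -ltnS prednK ?ltnn //; case: (G) gin.
case: (gG) => uG homG genG LG; exists G => //; split=> // G' sub gen' F FG.
apply/negPn/negP => FG'.
have Fin : in_ideal (rem F G) F.
  have /gen' : F \in I by apply/genG/mem_in_ideal.
  apply: in_ideal_trans => g gG'; apply: mem_in_ideal.
  rewrite mem_rem_uniq // inE sub // andbT.
  by apply: contraNneq FG' => <-.
have [FL|FL] := boolP (F \in L); last by case: (irr F).
have [d homF] := homL FL.
have [m [Fm otherL min_m]] := privateL FL.
have degF : mdeg m = d.
  apply/eqP; apply: contraNT Fm => /(dhomog_nemf_coeff homF).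
  by move/eqP.
have GI g : g \in G -> g \in I by move=> ?; apply/genG/mem_in_ideal.
have [c eF] := proj1 (in_idealP F (rem_uniq F uG)) Fin.
have coefF : F@_m =
    \sum_(g <- rem F G) (c g)@_0%MM * g@_m.
  transitivity ((\sum_(g <- rem F G) c g * g)@_m); first by rewrite -eF.
  rewrite raddf_sum /= big_seq [RHS]big_seq.
  apply: eq_bigr => g /mem_rem gin; apply: mcoeffM_minimal => m'.
  exact: min_m (GI g gin).
have /hasP[g gin nz] : has (fun g => (c g)@_0%MM * g@_m != 0) (rem F G).
  apply: contraNT Fm => /hasPn H; rewrite coefF big_seq big1 // => g.
  by move/H; rewrite negbK => /eqP.
have [c0 gl0] : (c g)@_0%MM != 0 /\ g@_m != 0.
  by apply/andP; move: nz; rewrite mulf_eq0 negb_or.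
move: gin; rewrite mem_rem_uniq // inE => /andP[gF gG'].
have gL : g \notin L.
  by apply: contra gl0 => gL; rewrite (otherL g gL gF).
have [e homg] := homG g gG'.
have ed : e = d.
  by apply/eqP; rewrite -degF eq_sym; apply: contraNT gl0 => /(dhomog_nemf_coeff homg)/eqP.
case: (irr g gG' gL).
(* Solve the degree-[d] part of the relation for [g]. *)
have : F = \sum_(g <- rem F G) pihomog mdeg d (c g * g).
  transitivity (pihomog mdeg d (\sum_(g <- rem F G) c g * g)); last exact: raddf_sum.
  by rewrite -eF pihomog_dE.
have grem : g \in rem F G by rewrite mem_rem_uniq // inE gF.
rewrite (bigD1_seq g grem (rem_uniq F uG)) /= (pihomogM _ _ homg) ed leqnn subnn.
rewrite pihomog0E => eF'.
have eg : g = (((c g)@_0%MM)^-1)%:MP * (F + -1 * \sum_(g' <- rem F G | g' != g)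
      pihomog mdeg d (c g' * g')).
  by rewrite {1}eF' mulN1r addrK mulrA -mpolyCM mulVf // mul1r.
rewrite [X in in_ideal _ X]eg.
apply: in_idealM; apply: in_idealD.
  by apply: mem_in_ideal; rewrite mem_rem_uniq // inE eq_sym gF.
rewrite big_seq_cond; apply: in_idealM; apply: in_ideal_sum => g' /andP[].
rewrite mem_rem_uniq // inE => /andP[_ g'G] g'g.
have [e' homg'] := homG g' g'G.
rewrite (pihomogM _ _ homg'); apply: in_idealM; apply: mem_in_ideal.
by rewrite mem_rem_uniq // inE g'g.
Qed.
End Extend.
End Graded.

(** * The action by differentiation and the apolar ideal of a form *)

Section DiffAct.
Variables (k : fieldType) (N : nat).
Implicit Types (p q h g F : {mpoly k[N]}) (m u : 'X_{1..N}).

Lemma diff_actwE b h F : (msize h <= b)%N ->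
  diff_act h F = \sum_(m : 'X_{1..N < b}) h@_m *: F^`M[m].
Proof.
move=> lehb; rewrite /diff_act (big_mksub 'X_{1..N < b}) //=; first last.
- by move=> m /msize_mdeg_lt /leq_trans; apply.
- exact: msupp_uniq.
by rewrite big_rmcond //= => m /memN_msupp_eq0 ->; rewrite scale0r.
Qed.

Lemma diff_actP c h g F :
  diff_act (c *: h + g) F = c *: diff_act h F + diff_act g F.
Proof.
pose_big_enough b.
  rewrite (diff_actwE (b := b)) // (diff_actwE (h := h) (b := b)) //.
  rewrite (diff_actwE (h := g) (b := b)) // scaler_sumr -big_split /=.
  by apply: eq_bigr => m _; rewrite mcoeffD mcoeffZ scalerDl scalerA.
by close.
Qed.

(** [diff_act] with its arguments exchanged, so that linearity in the operator
    can be declared too. *)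
Definition diff_by F h := diff_act h F.

Lemma diff_by_is_linear F : linear (diff_by F).
Proof. by move=> c h g; apply: diff_actP. Qed.

HB.instance Definition _ F :=
  GRing.isLinear.Build k {mpoly k[N]} {mpoly k[N]} _ (diff_by F)
    (diff_by_is_linear F).

Lemma diff_act_is_linear h : linear (diff_act h).
Proof.
move=> c F F'; rewrite /diff_act scaler_sumr -big_split /=.
apply: eq_bigr => m _; rewrite linearP /= scalerDr !scalerA.
by rewrite mulrC.
Qed.

HB.instance Definition _ h :=
  GRing.isLinear.Build k {mpoly k[N]} {mpoly k[N]} _ (diff_act h)
    (diff_act_is_linear h).

Lemma diff_actX m F : diff_act 'X_[m] F = F^`M[m].
Proof. by rewrite /diff_act msuppX big_seq1 mcoeffX eqxx scale1r. Qed.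

Lemma diff_actXU i F : diff_act 'X_i F = F^`M(i).
Proof. by rewrite diff_actX mderivmU1m. Qed.

Lemma diff_act_suml (J : Type) (r : seq J) (P : pred J) (f : J -> {mpoly k[N]}) F :
  diff_act (\sum_(j <- r | P j) f j) F = \sum_(j <- r | P j) diff_act (f j) F.
Proof. exact: (raddf_sum (diff_by F)). Qed.

Lemma diff_actZl c h F : diff_act (c *: h) F = c *: diff_act h F.
Proof. exact: (linearZZ (diff_by F)). Qed.

(** Partial derivatives commute and compose, so the polynomial ring acts; in
    particular [Ann F] is an ideal. *)
Lemma diff_actM h g F : diff_act (h * g) F = diff_act h (diff_act g F).
Proof.
rewrite [h]mpolyE mulr_suml !diff_act_suml; apply: eq_bigr => a _.
rewrite -scalerAl !diff_actZl diff_actX; congr (_ *: _).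
rewrite [g]mpolyE mulr_sumr !diff_act_suml raddf_sum; apply: eq_bigr => b _.
rewrite /= -scalerAr !diff_actZl mderivmZ; congr (_ *: _).
by rewrite -mpolyXD !diff_actX addmC mderivmDm.
Qed.

Lemma mcoeff_diff_act h F u : (diff_act h F)@_u =
  \sum_(m <- msupp h)
    h@_m * (F@_(m + u) *+ (\prod_(i < N) ((m + u)%MM i)^_(m i))%N).
Proof.
rewrite raddf_sum /=; apply: eq_bigr => m _.
by rewrite mcoeffZ mcoeff_mderivm.
Qed.

Lemma AnnP h F : reflect (diff_act h F = 0) (h \in Ann F).
Proof. exact: eqP. Qed.

Lemma Ann_mul c h F : h \in Ann F -> c * h \in Ann F.
Proof. by move=> /AnnP hF; apply/AnnP; rewrite diff_actM hF raddf0. Qed.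

Lemma AnnPl c h g F : h \in Ann F -> g \in Ann F -> c *: h + g \in Ann F.
Proof. by move=> /AnnP hF /AnnP gF; apply/AnnP; rewrite diff_actP hF gF scaler0 addr0. Qed.

Lemma Ann0 F : 0 \in Ann F.
Proof. by apply/AnnP; apply: (raddf0 (diff_by F)). Qed.

Lemma Ann_in_ideal G h F :
  (forall g, g \in G -> g \in Ann F) -> in_ideal G h -> h \in Ann F.
Proof.
move=> GA [c ->]; elim/big_ind: _ => [|p q pA qA|i _].
- exact: Ann0.
- by rewrite -[p]scale1r; apply: AnnPl.
- by apply: Ann_mul; apply: GA; apply: mem_nth.
Qed.

Section Homog.
Variables (n : nat) (F : {mpoly k[N]}).
Hypothesis homF : F \is n.-homog.

Lemma mcoeff_homog m : mdeg m != n -> F@_m = 0.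
Proof. exact: dhomog_nemf_coeff homF. Qed.

(** The parts of [h] of different degrees send a form [F] to forms of different
    degrees, which cannot cancel. *)
Lemma Ann_pihomog d h : h \in Ann F -> pihomog mdeg d h \in Ann F.
Proof.
move=> /AnnP hF; apply/AnnP/mpolyP => u; rewrite mcoeff0.
rewrite pihomogE diff_act_suml raddf_sum /=.
have [dun|dun] := eqVneq (d + mdeg u)%N n.
  transitivity (diff_act h F)@_u; last by rewrite hF mcoeff0.
  rewrite mcoeff_diff_act big_mkcond /=; apply: eq_bigr => m _.
  rewrite diff_actZl mcoeffZ diff_actX mcoeff_mderivm.
  case: eqP => // /eqP ned; rewrite mcoeff_homog ?mul0rn ?mulr0 //.
  by rewrite mdegD -dun eqn_add2r.
rewrite big1 // => m /eqP md.
rewrite diff_actZl mcoeffZ diff_actX mcoeff_mderivm.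
by rewrite mcoeff_homog ?mul0rn ?mulr0 // mdegD md.
Qed.

Lemma Ann_high_monomial m : (n < mdeg m)%N -> 'X_[m] \in Ann F.
Proof.
move=> lt; apply/AnnP; rewrite diff_actX; apply/mpolyP => u.
rewrite mcoeff_mderivm mcoeff0 mcoeff_homog ?mul0rn // mdegD.
by rewrite neq_ltn (leq_trans lt (leq_addr _ _)) orbT.
Qed.

End Homog.

(** Gaussian elimination, one monomial of [ms] at a time: if some element of the
    subspace [P] has a nonzero coefficient there, one such element suffices to
    clear it in all the others. *)
Lemma finite_span (P : {mpoly k[N]} -> Prop) (ms : seq 'X_{1..N}) :
    (forall c p q, P p -> P q -> P (c *: p + q)) ->
  exists2 gs : seq {mpoly k[N]}, (forall g, g \in gs -> P g)
    & forall h, P h -> (forall m, m \notin ms -> h@_m = 0) -> in_ideal gs h.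
Proof.
move=> closP; elim: ms => [|m ms [gs gsP spangs]].
  exists [::] => // h _ h0; suff -> : h = 0 by apply: in_ideal0.
  by apply/mpolyP => m; rewrite mcoeff0 h0.
have [[w [Pw suppw wm]]|none] := classic (exists w, [/\ P w,
    forall m', m' \notin m :: ms -> w@_m' = 0 & w@_m != 0]).
  exists (w :: gs) => [g|h Ph supph].
    by rewrite inE => /predU1P[->|/gsP].
  pose c := h@_m / w@_m.
  have -> : h = c%:MP * w + (- c *: w + h).
    by rewrite mul_mpolyC scaleNr addrA subrr add0r.
  apply: in_idealD; first by apply/in_idealM/mem_in_ideal/mem_head.
  have : in_ideal gs (- c *: w + h).
    apply: spangs => [|m' m'ms]; first exact: closP.
    rewrite mcoeffD mcoeffZ; have [->|ne] := eqVneq m' m.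
      by rewrite mulNr divfK // addNr.
    have nin : m' \notin m :: ms by rewrite inE negb_or ne.
    by rewrite suppw // supph // mulr0 addr0.
  apply: in_ideal_trans => g ggs; apply: mem_in_ideal.
  by rewrite inE ggs orbT.
exists gs => // h Ph supph; apply: spangs => // m' m'ms.
have [->|ne] := eqVneq m' m; last by apply: supph; rewrite inE negb_or ne.
by apply/eqP/negPn/negP => hm; apply: none; exists h.
Qed.

(** [Ann F] contains every monomial of degree above [n], so it is generated by
    spanning lists of its homogeneous parts of degree at most [n + 1]. *)
Lemma Ann_homog_finitely_generated n F : F \is n.-homog ->
  exists2 G, generates (Ann F) G
    & forall g, g \in G -> exists d : nat, g \is d.-homog.
Proof.
move=> homF.
have [G GP spanG] : exists2 G : seq {mpoly k[N]},
    (forall g, g \in G -> g \in Ann F /\ exists d : nat, g \is d.-homog)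
    & forall d h, (d < n.+2)%N -> h \in Ann F -> h \is d.-homog -> in_ideal G h.
  elim: (n.+2) => [|b [G GP spanG]]; first by exists [::].
  pose P h := h \in Ann F /\ h \is b.-homog.
  have closP c p q : P p -> P q -> P (c *: p + q).
    move=> [pA ph] [qA qh]; split; first exact: AnnPl.
    by apply: dhomogD => //; apply: dhomogZ.
  pose ms := [seq bmnm x | x <- enum {: 'X_{1..N < b.+1}}].
  have [gs gsP spangs] := finite_span ms closP.
  exists (gs ++ G) => [g|d h].
    by rewrite mem_cat => /orP[/gsP[]|/GP//]; split=> //; exists b.
  have sub : forall g, g \in G -> in_ideal (gs ++ G) g.
    by move=> g gG; apply: mem_in_ideal; rewrite mem_cat gG orbT.
  rewrite ltnS leq_eqVlt => /predU1P[->|ltd] hA homh; last first.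
    exact: in_ideal_trans sub (spanG d h ltd hA homh).
  have : in_ideal gs h.
    apply: spangs => // m mms; apply: (dhomog_nemf_coeff homh).
    apply: contra mms => /eqP mb; apply/mapP.
    have lt : (mdeg m < b.+1)%N by rewrite mb.
    by exists (BMultinom lt) => //; rewrite mem_enum.
  apply: in_ideal_trans => g ggs; apply: mem_in_ideal.
  by rewrite mem_cat ggs.
exists G => [h|g /GP[]//]; split; last first.
  by apply: Ann_in_ideal => g /GP[].
have high m : (n < mdeg m)%N -> in_ideal G 'X_[m].
  move md: (mdeg m) => d; elim: d m md => // d IH m md.
  rewrite ltnS leq_eqVlt => /predU1P[nd|ltnd].
    apply: (spanG n.+1) => //; last by rewrite dhomogX /= md nd.
    by apply: (Ann_high_monomial homF); rewrite md nd ltnSn.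
  have [i im] : exists i, m i != 0%N.
    apply/existsP; rewrite -negb_forall; apply: contraTN isT => /forallP m0.
    suff m00 : m = 0%MM by move: md; rewrite m00 mdeg0.
    by apply/mnmP => i; rewrite mnm0E; apply/eqP.
  have le : (U_(i) <= m)%MM by rewrite lep1mP.
  rewrite -(submK le) addmC mpolyXD; apply: in_idealM; apply: IH => //.
    by apply: succn_inj; rewrite -md -{2}(submK le) mdegD mdeg1 addn1.
move=> hA; rewrite (pihomog_partitionE (leqnn (msize h))).
apply: in_ideal_sum => d _.
have [ltd|led] := ltnP d n.+2.
  by apply: (spanG d) => //; [apply: (Ann_pihomog homF) | apply: pihomogP].
rewrite pihomogE; apply: in_ideal_sum => m /eqP md.
by rewrite -mul_mpolyC; apply: in_idealM; apply: high; rewrite md ltnW.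
Qed.

End DiffAct.

(** * Permanental minors of the generic symmetric matrix *)

Lemma mderiv_prod (k : fieldType) (N : nat) (J : finType) (P : pred J)
    (f : J -> {mpoly k[N]}) (v : 'I_N) :
  (\prod_(j | P j) f j)^`M(v) =
  \sum_(i | P i) (f i)^`M(v) * \prod_(j | P j && (j != i)) f j.
Proof.
elim: (index_enum J) (index_enum_uniq J) => [_|x r IH] /=.
  by rewrite !big_nil -mpolyC1 mderivC.
move=> /andP[xr ur]; rewrite !big_cons; case: ifP => Px; last first.
  by rewrite IH //; apply: eq_bigr => i Pi; rewrite big_cons Px.
have drop : \prod_(j <- r | P j && (j != x)) f j = \prod_(j <- r | P j) f j.
  rewrite big_seq_cond [RHS]big_seq_cond; apply: eq_bigl => j.
  by case: eqVneq => [->|]; rewrite ?(negbTE xr) ?andbT.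
rewrite mderivM IH // eqxx andbF drop; congr (_ + _).
rewrite mulr_sumr big_seq_cond [RHS]big_seq_cond; apply: eq_bigr => i /andP[ir Pi].
rewrite big_cons Px; have -> : x != i by apply: contraNneq xr => ->.
by rewrite mulrCA.
Qed.

Lemma sidx_eq (n : nat) (i j a b : 'I_n) :
  (sidx i j == sidx a b) = (i == a) && (j == b) || (i == b) && (j == a).
Proof.
rewrite -val_eqE /= /sort2; apply/eqP/orP.
  by case: leqP => _; case: leqP => _ [-> ->]; rewrite !eqxx; [left|right|right|left].
case=> /andP[/eqP -> /eqP ->] //.
by case: (ltngtP a b) => // /val_inj ->.
Qed.

(** The permutation sends the entry of [xs] at each position to the entry of [ys]
    at that position. *)
Lemma perm_eq_permutation (T : finType) (xs ys : seq T) :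
  uniq xs -> perm_eq xs ys -> exists s : {perm T}, map s xs = ys /\
    forall x, x \notin xs -> s x = x.
Proof.
move=> uxs pxy; have sz := perm_size pxy.
pose f x := nth x ys (index x xs).
have fin x : x \in xs -> f x \in xs.
  by move=> xin; rewrite (perm_mem pxy) mem_nth // -sz index_mem.
have fout x : x \notin xs -> f x = x.
  by move=> xin; rewrite /f nth_default // -sz leqNgt index_mem.
have uys : uniq ys by rewrite -(perm_uniq pxy).
have finj : injective f.
  move=> x y e; have [xin|xin] := boolP (x \in xs); have [yin|yin] := boolP (y \in xs).
  - move: e; rewrite /f (set_nth_default y) -?sz ?index_mem // => /eqP.
    by rewrite nth_uniq -?sz ?index_mem // => /eqP/(index_inj x xin yin).
  - by move: (fin x xin); rewrite e (fout y yin) (negbTE yin).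
  - by move: (fin y yin); rewrite -e (fout x xin) (negbTE xin).
  - by rewrite -(fout x xin) e fout.
exists (perm finj); split=> [|x xin]; last by rewrite permE fout.
case: xs => [|x0 xs'] in uxs pxy sz f fin fout finj *; first by case: (ys) sz.
apply: (@eq_from_nth _ x0); rewrite size_map // => i ilt.
rewrite (nth_map x0) // permE /f index_uniq // (set_nth_default x0) //.
by rewrite -sz.
Qed.

Section Minors.
Variables (k : fieldType) (n : nat).
Implicit Types (rs cs : seq 'I_n) (i j a b : 'I_n) (s : 'S_n).

(** The permanent of the generic symmetric matrix with the rows [rs] and the
    columns [cs] deleted, as a sum over the permutations that send [rs] to [cs]
    entry by entry. Prescribing only the set [cs] would count each term
    [(size rs)`!] times, and that factor can vanish in [k]. *)
Definition minor rs cs : sympoly k n :=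
  \sum_(s : 'S_n | map s rs == cs) \prod_(i | i \notin rs) symvar k i (s i).

Lemma permanent_minor : permanent (generic_symmx k n) = minor [::] [::].
Proof.
rewrite /permanent /minor; apply: eq_big => // s _.
by apply: eq_big => // i _; rewrite mxE.
Qed.

Definition partial a b (p : sympoly k n) := p^`M(enum_rank (sidx a b)).

Lemma diff_symvar a b p : diff_act (symvar k a b) p = partial a b p.
Proof. exact: diff_actXU. Qed.

Lemma partial_symvar a b i j :
  partial a b (symvar k i j) = (sidx i j == sidx a b)%:R.
Proof.
rewrite /partial mderivX mnm1E (inj_eq enum_rank_inj).
case: eqP => [->|_]; last by rewrite scale0r.
have -> : (U_(enum_rank (sidx a b)) - U_(enum_rank (sidx a b)) = 0)%MM.
  by apply/mnmP => x; rewrite mnmBE mnm0E subnn.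
by rewrite mpolyX0 scale1r.
Qed.

(** The part of the derivative that comes from the factor in row [a] and column
    [b]: it deletes that row and that column. *)
Lemma partial_minor_pick rs cs a b : a \notin rs ->
  \sum_(s : 'S_n | map s rs == cs) \sum_(i | i \notin rs)
    ((i == a) && (s i == b))%:R *
      \prod_(j | (j \notin rs) && (j != i)) symvar k j (s j)
  = minor (a :: rs) (b :: cs).
Proof.
move=> ars; rewrite /minor [RHS](eq_bigl (fun s => (map s rs == cs) && (s a == b))); last first.
  by move=> s; rewrite andbC.
rewrite [RHS]big_mkcondr /=; apply: eq_bigr => s _.
rewrite (bigD1 a) //= eqxx [X in _ + X]big1 ?addr0; last first.
  by move=> i /andP[_ /negbTE ->]; rewrite mul0r.
case: eqP => _; last by rewrite mul0r.
by rewrite mul1r; apply: eq_bigl => i; rewrite inE negb_or andbC.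
Qed.

Lemma partial_minor_expand rs cs a b :
  partial a b (minor rs cs) =
  \sum_(s : 'S_n | map s rs == cs) \sum_(i | i \notin rs)
    (sidx i (s i) == sidx a b)%:R *
      \prod_(j | (j \notin rs) && (j != i)) symvar k j (s j).
Proof.
rewrite /partial /minor raddf_sum; apply: eq_bigr => s _ /=.
by rewrite mderiv_prod; apply: eq_bigr => i _; rewrite -partial_symvar.
Qed.

Lemma partial_diag_minor rs cs a : a \notin rs ->
  partial a a (minor rs cs) = minor (a :: rs) (a :: cs).
Proof.
move=> ars; rewrite partial_minor_expand -partial_minor_pick //.
by apply: eq_bigr => s _; apply: eq_bigr => i _; rewrite sidx_eq orbb.
Qed.

(** The variable with indices [a] and [b] occupies the two positions [(a, b)] and
    [(b, a)] of the matrix, hence two terms. *)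
Lemma partial_minor rs cs a b : a != b -> a \notin rs -> b \notin rs ->
  partial a b (minor rs cs) = minor (a :: rs) (b :: cs) + minor (b :: rs) (a :: cs).
Proof.
move=> ab ars brs; rewrite partial_minor_expand -!partial_minor_pick //.
rewrite -big_split; apply: eq_bigr => s _; rewrite -big_split.
apply: eq_bigr => i _ /=; rewrite sidx_eq -mulrDl; congr (_ * _).
have [ia|] := eqVneq i a; last by rewrite add0r.
by rewrite ia (negbTE ab) orbF addr0.
Qed.

(** Symmetry of the matrix: pass to the inverse permutations. *)
Lemma minorC rs cs : minor rs cs = minor cs rs.
Proof.
rewrite /minor (reindex_inj invg_inj) /=; apply: eq_big => [s|s /eqP e].
  apply/eqP/eqP => <-; rewrite -map_comp map_id_in // => x _ /=.
    by rewrite permKV.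
  by rewrite permK.
rewrite (reindex_inj (@perm_inj _ s)) /=; apply: eq_big => [i|i _].
  by rewrite -e -[in RHS](permK s i) mem_map //; apply: perm_inj.
by rewrite permK symvarC.
Qed.

(** Compose the permutations with one that rearranges the deleted columns and
    fixes the others. *)
Lemma minor_permr rs cs cs' : uniq cs -> perm_eq cs cs' -> minor rs cs = minor rs cs'.
Proof.
move=> ucs /perm_eq_permutation[//|t [tcs tout]].
rewrite /minor [RHS](reindex_inj (mulIg t)) /=.
have mapM s : map (s * t)%g rs = map t (map s rs).
  by rewrite -map_comp; apply: eq_map => x; rewrite /= permM.
apply: eq_big => [s|s /eqP e].
  by rewrite mapM -tcs (inj_eq (inj_map (@perm_inj _ t))).
apply: eq_bigr => i irs; rewrite permM tout // -e mem_map //; exact: perm_inj.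
Qed.

Lemma minor_perm rs rs' cs cs' : uniq rs -> uniq cs ->
  perm_eq rs rs' -> perm_eq cs cs' -> minor rs cs = minor rs' cs'.
Proof.
move=> urs ucs pr pc; rewrite (minor_permr _ ucs pc) minorC.
by rewrite (minor_permr _ urs pr) minorC.
Qed.

Lemma minor_laplace rs cs i : i \notin rs ->
  minor rs cs = \sum_j symvar k i j * minor (i :: rs) (j :: cs).
Proof.
move=> irs; rewrite {1}/minor (partition_big (fun s : 'S_n => s i) xpredT) //=.
apply: eq_bigr => j _; rewrite /minor mulr_sumr.
apply: eq_big => [s|s /andP[_ /eqP sij]]; first by rewrite andbC.
rewrite (bigD1 i) //= sij; congr (_ * _).
by apply: eq_bigl => x; rewrite inE negb_or andbC.
Qed.

Lemma minor_not_uniq rs cs : uniq rs -> ~~ uniq cs -> minor rs cs = 0.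
Proof.
move=> urs ucs; rewrite /minor big1 // => s /eqP e; case/negP: ucs.
by rewrite -e map_inj_uniq //; apply: perm_inj.
Qed.

Lemma minor_full rs cs : uniq rs -> uniq cs -> size rs = n -> size cs = n ->
  minor rs cs = 1.
Proof.
move=> urs ucs srs scs.
have full (xs : seq 'I_n) : uniq xs -> size xs = n -> perm_eq xs (enum 'I_n).
  move=> ux sx; apply: uniq_perm => //; first exact: enum_uniq.
  by case: (@uniq_min_size _ xs (enum 'I_n)) => // [x _|]; rewrite ?mem_enum // size_enum_ord sx.
rewrite (minor_perm urs ucs (full _ urs srs) (full _ ucs scs)) /minor.
rewrite (big_pred1 1%g) => [|s]; first by rewrite big_pred0 // => i; rewrite mem_enum.
apply/eqP/eqP => [e|->]; last by rewrite (eq_map (@perm1 _)) map_id.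
apply/permP => x; rewrite perm1.
have := congr1 (fun q => nth x q x) e.
by rewrite (nth_map x) ?size_enum_ord // nth_ord_enum.
Qed.

End Minors.

(** * Quadratic monomials annihilated by the apolar ideal *)

Section Quadrics.
Variables (k : fieldType) (n : nat).
Implicit Types (rs cs : seq 'I_n) (i j a b c d : 'I_n).

Notation X := (symvar k).
Notation perm_poly := (permanent (generic_symmx k n)).

Definition listing rs := perm_eq rs (enum 'I_n).

Lemma listing_uniq rs : listing rs -> uniq rs.
Proof. by move=> /perm_uniq ->; apply: enum_uniq. Qed.

Lemma minor_listing rs cs : listing rs -> listing cs -> minor k rs cs = 1.
Proof.
move=> hr hc; apply: minor_full; rewrite ?listing_uniq //.
  by rewrite (perm_size hr) size_enum_ord.
by rewrite (perm_size hc) size_enum_ord.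
Qed.

Lemma listing_mem rs i : listing rs -> i \in rs.
Proof. by move=> /perm_mem ->; rewrite mem_enum. Qed.

Lemma minor_corank1 rs cs i j : listing (i :: rs) -> listing (j :: cs) ->
  minor k rs cs = X i j.
Proof.
move=> hr hc; have /= /andP[irs urs] := listing_uniq hr.
rewrite (minor_laplace _ _ irs) (bigD1 j) //= minor_listing // mulr1.
rewrite big1 ?addr0 // => j' nej.
rewrite minor_not_uniq ?mulr0 //=; first by rewrite irs.
by have := listing_mem j' hc; rewrite inE (negbTE nej) /= => ->.
Qed.

Lemma minor_corank2 rs cs i i' j j' :
    listing (i :: i' :: rs) -> listing (j :: j' :: cs) ->
  minor k rs cs = X i j * X i' j' + X i j' * X i' j.
Proof.
move=> hr hc; have := listing_uniq hr.
rewrite cons_uniq inE negb_or => /andP[/andP[ii' irs] ui'].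
have := listing_uniq hc; rewrite cons_uniq inE negb_or => /andP[/andP[jj' jcs] uj'].
have swap x y zs : perm_eq (x :: y :: zs) (y :: x :: zs) :> bool.
  by apply/seq.permP => P /=; rewrite addnCA.
have hr' : listing (i' :: i :: rs) by rewrite /listing (permPl (swap _ _ _ _)).
rewrite (minor_laplace _ _ irs) (bigD1 j) //= (bigD1 j') 1?eq_sym //=.
rewrite (minor_corank1 (i := i') (j := j')) //; last first.
  by rewrite /listing (permPl (swap _ _ _ _)).
rewrite (minor_corank1 (i := i') (j := j) hr') // addrA.
rewrite big1 ?addr0 // => j'' /andP[nej nej'].
rewrite minor_not_uniq ?mulr0 //=; first by rewrite irs; case/andP: ui'.
by have := listing_mem j'' hc; rewrite !inE (negbTE nej) (negbTE nej') /= => ->.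
Qed.

Lemma diff_act_diagonal rs : uniq rs ->
  diff_act (\prod_(i <- rs) X i i) perm_poly = minor k rs rs.
Proof.
elim: rs => [_|a rs IH /= /andP[ars urs]].
  by rewrite big_nil permanent_minor -mpolyX0 diff_actX mderivm0m.
by rewrite big_cons diff_actM IH // diff_symvar partial_diag_minor.
Qed.

(** The diagonal variables delete all rows and columns but four, and the two
    edges are then oriented in four ways, each leaving a permanent of size two.
    The result is symmetric in the three ways to split [a, b, c, d] into pairs,
    apart from the weights 4, 2, 2. *)
Lemma quadric_action a b c d rs : listing [:: a, b, c, d & rs] ->
  diff_act (X a b * X c d * \prod_(i <- rs) X i i) perm_poly =
  4%:R *: (X a b * X c d) + 2%:R *: (X a c * X b d) + 2%:R *: (X a d * X b c).
Proof.
move=> H; have := listing_uniq H.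
rewrite /= !inE !negb_or -!andbA => /and5P[ab ac ad ars /and5P[bc bd brs cd]].
move=> /and3P[crs drs urs].
have L xs : perm_eq xs [:: a, b, c, d & rs] -> listing xs.
  by move=> p; rewrite /listing (permPl p).
rewrite !diff_actM diff_act_diagonal // !diff_symvar.
rewrite partial_minor // /partial linearD /= -!/(partial _ _ _).
rewrite !partial_minor ?inE ?negb_or ?ac ?ad ?bc ?bd //.
rewrite (@minor_corank2 _ _ b d a c); first last.
- by apply: L; apply/seq.permP => P /=; ring.
- by apply: L; apply/seq.permP => P /=; ring.
rewrite (@minor_corank2 _ _ a d b c); first last.
- by apply: L; apply/seq.permP => P /=; ring.
- by apply: L; apply/seq.permP => P /=; ring.
rewrite (@minor_corank2 _ _ b c a d); first last.
- by apply: L; apply/seq.permP => P /=; ring.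
- by apply: L; apply/seq.permP => P /=; ring.
rewrite (@minor_corank2 _ _ a c b d); first last.
- by apply: L; apply/seq.permP => P /=; ring.
- by apply: L; apply/seq.permP => P /=; ring.
rewrite (symvarC k b a) (symvarC k d c) (symvarC k c b) (symvarC k d b).
rewrite (symvarC k d a) (symvarC k c a) !scaler_nat; ring.
Qed.

Lemma complement_listing a b c d : uniq [:: a; b; c; d] ->
  exists rs, listing [:: a, b, c, d & rs].
Proof.
move=> u; exists [seq x <- enum 'I_n | x \notin [:: a; b; c; d]].
apply: uniq_perm; last 2 first.
- exact: enum_uniq.
- move=> x; rewrite -[_ :: _]/([:: a; b; c; d] ++ _) mem_cat mem_filter.
  by rewrite mem_enum andbT orbN.
rewrite -[_ :: _]/([:: a; b; c; d] ++ _) cat_uniq u filter_uniq ?enum_uniq //.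
rewrite andbT; apply/hasPn => x /=; by rewrite mem_filter => /andP[].
Qed.

Hypothesis two_neq0 : (2%:R : k) != 0.

(** An operator that annihilates a polynomial annihilates its derivatives. By
    [quadric_action] these contain the combinations with weights (4, 2, 2),
    (2, 4, 2) and (2, 2, 4) of the three products of pairs; they span the
    products, since the determinant of this system is 32. *)
Lemma Ann_kills_quadric h a b c d : uniq [:: a; b; c; d] ->
  h \in Ann perm_poly -> diff_act h (X a b * X c d) = 0.
Proof.
move=> u /AnnP hA; have [rs H] := complement_listing u.
have kill x y z t : perm_eq [:: x, y, z, t & rs] [:: a, b, c, d & rs] ->
    diff_act h (4%:R *: (X x y * X z t) + 2%:R *: (X x z * X y t)
       + 2%:R *: (X x t * X y z)) = 0.
  move=> p; rewrite -(@quadric_action _ _ _ _ rs); last by rewrite /listing (permPl p).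
  by rewrite -diff_actM mulrC diff_actM hA raddf0.
have k1 := kill a b c d (perm_refl _).
have k2 : diff_act h (4%:R *: (X a c * X b d) + 2%:R *: (X a b * X c d)
       + 2%:R *: (X a d * X b c)) = 0.
  rewrite (symvarC k b c); apply: kill; apply/seq.permP => P /=; ring.
have k3 : diff_act h (4%:R *: (X a d * X b c) + 2%:R *: (X a b * X c d)
       + 2%:R *: (X a c * X b d)) = 0.
  rewrite (symvarC k c d) (symvarC k b d).
  by apply: kill; apply/seq.permP => P /=; ring.
(* 3 (4, 2, 2) - (2, 4, 2) - (2, 2, 4) = (8, 0, 0) *)
have e : (2%:R ^+ 3 : k) *: (X a b * X c d) =
    3%:R *: (4%:R *: (X a b * X c d) + 2%:R *: (X a c * X b d)
       + 2%:R *: (X a d * X b c))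
    - (4%:R *: (X a c * X b d) + 2%:R *: (X a b * X c d)
       + 2%:R *: (X a d * X b c))
    - (4%:R *: (X a d * X b c) + 2%:R *: (X a b * X c d)
       + 2%:R *: (X a c * X b d)).
  by rewrite -natrX !scaler_nat; ring.
apply: (scalerI (expf_neq0 3 two_neq0)).
by rewrite -linearZZ e !linearB linearZZ /= k1 k2 k3 !scaler0 !subr0.
Qed.

(** Applied to the squarefree monomial [M], the term of [h] at a divisor [m] of
    [M] yields its coefficient times the monomial [M - m], and no other term of
    [h] yields that monomial. *)
Lemma Ann_coef_quadric h a b c d m : uniq [:: a; b; c; d] ->
  h \in Ann perm_poly ->
  (m <= U_(enum_rank (sidx a b)) + U_(enum_rank (sidx c d)))%MM -> h@_m = 0.
Proof.
move=> u hA; set M := (_ + _)%MM => lemM.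
have := congr1 (mcoeff (M - m)%MM) (Ann_kills_quadric u hA).
rewrite /symvar -mpolyXD -/M mcoeff_diff_act mcoeff0.
have [min|] := boolP (m \in msupp h); last by move/memN_msupp_eq0.
rewrite (bigD1_seq m) ?msupp_uniq //= [X in _ + X]big1_seq ?addr0; last first.
  move=> m' /andP[ne _]; rewrite mcoeffX; case: eqP => [e|]; last by rewrite mul0rn mulr0.
  case/eqP: ne; apply: (@addIm _ (M - m)%MM).
  by rewrite -e [RHS]addmC submK.
have eM : (m + (M - m) = M)%MM by rewrite addmC submK.
rewrite mcoeffX eM eqxx big1 ?mulr1 // => i _.
have le1 : (M i <= 1)%N.
  have ne : sidx a b != sidx c d.
    move: u; rewrite sidx_eq /= !inE !negb_or -!andbA.
    by case/and5P=> _ /negbTE -> /negbTE ->.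
  rewrite mnmDE !mnm1E; case: eqP => [<-|_]; last by case: eqP.
  by rewrite (inj_eq enum_rank_inj) eq_sym (negbTE ne).
have := mnm_lepP lemM i; case: (m i) => [_|[ge1|x]]; first by rewrite ffactn0.
  by have /eqP -> : M i == 1%N by rewrite eqn_leq le1.
by rewrite leqNgt (leq_trans (_ : M i < 2)%N).
Qed.

End Quadrics.

(** * The monomials of the cubics *)

(** A product of three variables that involves each of the six chosen indices
    once is a perfect matching of 1, ..., 6, given by its edges [(a, b)] with
    [a < b], in increasing order. *)
Definition matching := seq (nat * nat).

(** The five cubics as lists of signed matchings, [true] standing for the sign
    -1, so that the finite verifications about them can be computed. *)
Definition cubic_table : seq (seq (bool * matching)) :=
  [:: [:: (false, [:: (1, 5); (2, 4); (3, 6)]); (true, [:: (1, 4); (2, 5); (3, 6)]);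
          (true, [:: (1, 5); (2, 3); (4, 6)]); (false, [:: (1, 3); (2, 5); (4, 6)]);
          (false, [:: (1, 4); (2, 3); (5, 6)]); (true, [:: (1, 3); (2, 4); (5, 6)])];
      [:: (false, [:: (1, 4); (2, 6); (3, 5)]); (true, [:: (1, 4); (2, 5); (3, 6)]);
          (true, [:: (1, 3); (2, 6); (4, 5)]); (false, [:: (1, 2); (3, 6); (4, 5)]);
          (false, [:: (1, 3); (2, 5); (4, 6)]); (true, [:: (1, 2); (3, 5); (4, 6)])];
      [:: (false, [:: (1, 6); (2, 4); (3, 5)]); (true, [:: (1, 4); (2, 5); (3, 6)]);
          (true, [:: (1, 6); (2, 3); (4, 5)]); (false, [:: (1, 2); (3, 6); (4, 5)]);
          (false, [:: (1, 3); (2, 5); (4, 6)]); (true, [:: (1, 2); (3, 5); (4, 6)]);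
          (false, [:: (1, 4); (2, 3); (5, 6)]); (true, [:: (1, 3); (2, 4); (5, 6)])];
      [:: (false, [:: (1, 5); (2, 6); (3, 4)]); (true, [:: (1, 4); (2, 5); (3, 6)]);
          (true, [:: (1, 3); (2, 6); (4, 5)]); (false, [:: (1, 2); (3, 6); (4, 5)]);
          (true, [:: (1, 5); (2, 3); (4, 6)]); (false, [:: (1, 3); (2, 5); (4, 6)]);
          (false, [:: (1, 4); (2, 3); (5, 6)]); (true, [:: (1, 2); (3, 4); (5, 6)])];
      [:: (false, [:: (1, 6); (2, 5); (3, 4)]); (true, [:: (1, 4); (2, 5); (3, 6)]);
          (true, [:: (1, 6); (2, 3); (4, 5)]); (false, [:: (1, 2); (3, 6); (4, 5)]);
          (false, [:: (1, 4); (2, 3); (5, 6)]); (true, [:: (1, 2); (3, 4); (5, 6)])]]%N.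

Definition matchings : seq matching := [seq t.2 | t <- flatten cubic_table].

Definition endpoints (mu : matching) : seq nat := flatten [seq [:: e.1; e.2] | e <- mu].

(** The matching in the first term, which occurs in none of the other cubics
    (see [lead_private]). *)
Definition lead (D : seq (bool * matching)) : matching := (head (false, [::]) D).2.

Lemma matchings_perfect : all (fun mu => [&& perm_eq (endpoints mu) (iota 1 6),
  size mu == 3 & all (fun e => e.1 < e.2)%N mu]) matchings.
Proof. by vm_compute. Qed.

(** The edges are listed in a fixed order, so two matchings with the same edges
    are equal as lists. *)
Lemma matchings_antichain : all (fun mu => all (fun nu =>
  all [in nu] mu ==> (mu == nu)) matchings) matchings.
Proof. by vm_compute. Qed.

Lemma lead_private : all (fun D => all (fun D' =>
  [seq t <- D | t.2 == lead D'] ==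
    (if D == D' then [:: (false, lead D')] else [::])) cubic_table) cubic_table.
Proof. by vm_compute. Qed.

Section Cubics.
Variables (k : fieldType) (n : nat).
Implicit Types (i j : {ffun 'I_6 -> 'I_n}) (mu nu : matching).

Definition vertex i (x : nat) : 'I_n := i (inord x.-1).

Definition edge i (e : nat * nat) : 'I_(nvar n) :=
  enum_rank (sidx (vertex i e.1) (vertex i e.2)).

Definition matching_mnm i mu : 'X_{1..nvar n} := (\sum_(e <- mu) U_(edge i e))%MM.

Definition cubic i (D : seq (bool * matching)) : sympoly k n :=
  \sum_(t <- D) (-1) ^+ t.1 *: 'X_[matching_mnm i t.2].

Lemma matching_monomial3 i a b c d e f :
  'X_[matching_mnm i [:: (a, b); (c, d); (e, f)]] =
  zvar k i a b * zvar k i c d * zvar k i e f.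
Proof.
by rewrite /matching_mnm !big_cons big_nil addm0 !mpolyXD mulrA.
Qed.

Lemma five_cubicsE i : five_cubics k i = [seq cubic i D | D <- cubic_table].
Proof.
rewrite /five_cubics /cubic_table /= /cubic.
do 5?congr (_ :: _).
all: rewrite !big_cons big_nil !matching_monomial3.
all: move: (zvar k i) => z /=.
all: by rewrite !scaleN1r !scale1r addr0 !addrA.
Qed.

Lemma all_cubicsE :
  all_cubics k n = [seq cubic i D | i <- enum (incr6 n), D <- cubic_table].
Proof.
rewrite /all_cubics -(allpairs_mapr (fun _ F => F)).
by congr flatten; apply: eq_map => i; rewrite five_cubicsE.
Qed.

Lemma incr6P i : reflect {homo i : a b / (a < b)%N} (i \in incr6 n).
Proof.
rewrite inE; apply: (iffP forallP) => [H a b|H a].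
  by move/forallP: (H a) => /(_ b) /implyP.
by apply/forallP => b; apply/implyP; apply: H.
Qed.

Lemma incr6_inj i : i \in incr6 n -> injective i.
Proof.
move=> /incr6P H a b e; apply: val_inj; case: (ltngtP a b) => // /H.
  by rewrite e ltnn.
by rewrite e ltnn.
Qed.

Lemma vertex_inj i : i \in incr6 n -> {in iota 1 6 &, injective (vertex i)}.
Proof.
move=> /incr6_inj inj x y; rewrite !mem_iota => /andP[x1 x6] /andP[y1 y6] /inj.
move/(congr1 val); case: x y x1 x6 y1 y6 => [|x] [|y] //= _ x6 _ y6.
by rewrite !inordK // => ->.
Qed.

Lemma sorted_enum6 i : i \in incr6 n ->
  sorted ltn [seq val x | x <- [seq i a | a <- enum 'I_6]].
Proof.
move=> /incr6P H; rewrite -map_comp.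
apply: (@homo_sorted _ _ _ (relpre val ltn)) => [a b /=|]; first exact: H.
by rewrite -sorted_map val_enum_ord iota_ltn_sorted.
Qed.

Lemma card_incr6 : #|incr6 n| = 'C(n, 6).
Proof.
rewrite -card_ltn_sorted_tuples.
pose f (t : 6.-tuple 'I_n) : {ffun 'I_6 -> 'I_n} := [ffun a => tnth t a].
have finj : injective f.
  move=> t u /ffunP e; apply: eq_from_tnth => a.
  by have := e a; rewrite !ffunE.
rewrite -(card_imset _ finj); apply: eq_card => i; apply/idP/imsetP.
  move=> Hi; exists [tuple i a | a < 6].
    rewrite inE; have := sorted_enum6 Hi; by rewrite -val_ord_tuple.
  by apply/ffunP => a; rewrite ffunE tnth_mktuple.
move=> [t]; rewrite inE => st ->; apply/incr6P => a b ab; rewrite !ffunE.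
have := sorted_ltn_nth ltn_trans 0%N st.
move=> /(_ a b); rewrite !inE size_map size_tuple !ltn_ord => /(_ isT isT ab).
by rewrite !(nth_map (tnth t a)) ?size_tuple ?ltn_ord // -!tnth_nth.
Qed.

Lemma size_all_cubics : size (all_cubics k n) = (5 * 'C(n, 6))%N.
Proof. by rewrite all_cubicsE size_allpairs -cardE card_incr6 mulnC. Qed.

Lemma incr6_eq_image i j : i \in incr6 n -> j \in incr6 n ->
  (forall v, (v \in codom i) = (v \in codom j)) -> i = j.
Proof.
move=> Hi Hj e.
have E : [seq i a | a <- enum 'I_6] = [seq j a | a <- enum 'I_6].
  apply: (inj_map val_inj); apply: (irr_sorted_eq ltn_trans ltnn); try exact: sorted_enum6.
  move=> x; apply/mapP/mapP => -[v vin ->]; exists v => //.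
    by rewrite -[_ \in _]/(v \in codom j) -e.
  by rewrite -[_ \in _]/(v \in codom i) e.
by apply/ffunP => a; move/eq_in_map: E; apply; rewrite mem_enum.
Qed.

Lemma matching_mnmE i mu v :
  matching_mnm i mu v = count (fun e => edge i e == v) mu.
Proof.
rewrite /matching_mnm mnm_sumE -sum1_count [RHS]big_mkcond /=.
by apply: eq_bigr => e _; rewrite mnm1E; case: eqP.
Qed.

Lemma matching_mnm_sub i j mu nu : matching_mnm i mu = matching_mnm j nu ->
  forall e, e \in mu -> exists2 e', e' \in nu & edge i e = edge j e'.
Proof.
move=> E e emu; have : (0 < matching_mnm j nu (edge i e))%N.
  by rewrite -E matching_mnmE -has_count; apply/hasP; exists e.
by rewrite matching_mnmE -has_count => /hasP[e' e'nu /eqP <-]; exists e'.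
Qed.

Lemma edge_eq i j e e' : edge i e = edge j e' ->
  (vertex i e.1 = vertex j e'.1 /\ vertex i e.2 = vertex j e'.2) \/
  (vertex i e.1 = vertex j e'.2 /\ vertex i e.2 = vertex j e'.1).
Proof.
move=> /enum_rank_inj/eqP; rewrite sidx_eq => /orP[]/andP[/eqP -> /eqP ->].
  by left.
by right.
Qed.

Lemma perfectP mu : mu \in matchings -> [/\ perm_eq (endpoints mu) (iota 1 6),
  size mu = 3 & forall e, e \in mu -> (e.1 < e.2)%N].
Proof. by move=> /(allP matchings_perfect) /and3P[? /eqP ? /allP ?]. Qed.

Lemma mem_endpoints mu e : e \in mu -> (e.1 \in endpoints mu) && (e.2 \in endpoints mu).
Proof.
by move=> emu; apply/andP; split; apply/flatten_mapP; exists e; rewrite ?inE ?eqxx ?orbT.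
Qed.

Lemma edge_label mu e : mu \in matchings -> e \in mu ->
  (e.1 \in iota 1 6) && (e.2 \in iota 1 6).
Proof. by move=> /perfectP[/perm_mem p _ _] /mem_endpoints; rewrite !p. Qed.

Lemma matching_mnm_codom i j mu nu : mu \in matchings ->
  matching_mnm i mu = matching_mnm j nu -> {subset codom i <= codom j}.
Proof.
move=> /perfectP[p _ _] E _ /codomP[a ->].
have : a.+1 \in endpoints mu by rewrite (perm_mem p) mem_iota /= add1n ltnS ltn_ord.
move=> /flatten_mapP[e emu]; have [e' _ /edge_eq ee'] := matching_mnm_sub E emu.
have -> : i a = vertex i a.+1 by rewrite /vertex /= inord_val.
rewrite !inE => /orP[]/eqP ->; case: ee' => -[q1 q2]; rewrite ?q1 ?q2 codom_f //.
Qed.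

(** The monomial determines the indices that occur in it, hence the increasing
    map [i]; as [i] is injective, it then determines the edges. *)
Lemma matching_mnm_inj i j mu nu : i \in incr6 n -> j \in incr6 n ->
  mu \in matchings -> nu \in matchings ->
  matching_mnm i mu = matching_mnm j nu -> i = j /\ mu = nu.
Proof.
move=> Hi Hj Hmu Hnu E.
have ij : i = j.
  apply: incr6_eq_image => // v; apply/idP/idP.
    exact: matching_mnm_codom Hmu E v.
  exact: matching_mnm_codom Hnu (esym E) v.
split=> //; apply/eqP; apply: (implyP (allP (allP matchings_antichain _ Hmu) _ Hnu)).
apply/allP => e emu /=; have [e' e'nu /edge_eq ee'] := matching_mnm_sub E emu.
have /andP[e1 e2] := edge_label Hmu emu; have /andP[e1' e2'] := edge_label Hnu e'nu.
have [_ _ /(_ e emu) lt] := perfectP Hmu; have [_ _ /(_ e' e'nu) lt'] := perfectP Hnu.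
rewrite -ij in ee'; have inj := vertex_inj Hi.
case: e e' => [x y] [x' y'] /= in emu e'nu ee' e1 e2 e1' e2' lt lt' *.
case: ee' => -[/inj a /inj b]; first by rewrite a // b.
by move: lt; rewrite a // b // ltnNge ltnW.
Qed.

Lemma mem_matchings D t : D \in cubic_table -> t \in D -> t.2 \in matchings.
Proof. by move=> HD tD; apply: map_f; apply/flattenP; exists D. Qed.

Lemma lead_matchings D : D \in cubic_table -> lead D \in matchings.
Proof. by move: D; apply/allP; vm_compute. Qed.

(** The monomial of [lead D] on the rows and columns [i] is private to the cubic
    of [D] on [i], among all cubics on all choices of rows and columns. *)
Lemma mcoeff_cubic_lead i j D D' : i \in incr6 n -> j \in incr6 n ->
  D \in cubic_table -> D' \in cubic_table ->
  (cubic i D)@_(matching_mnm j (lead D')) = ((i == j) && (D == D'))%:R.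
Proof.
move=> Hi Hj HD HD'; rewrite /cubic raddf_sum /=.
transitivity (\sum_(t <- D | (i == j) && (t.2 == lead D')) (-1) ^+ t.1 : k).
  rewrite [RHS]big_mkcond /= !big_seq; apply: eq_bigr => t tD.
  rewrite mcoeffZ mcoeffX; case: eqP => [/matching_mnm_inj|ne].
    by case=> // [||-> ->]; rewrite ?eqxx ?mulr1 ?(mem_matchings HD tD) ?lead_matchings.
  rewrite mulr0; case: andP => // -[/eqP ij /eqP tl]; by case: ne; rewrite ij tl.
case: eqP => _ /=; last by rewrite big_pred0.
rewrite -big_filter (eqP (allP (allP lead_private _ HD) _ HD')).
by case: eqP => _; rewrite ?big_nil // big_seq1 expr0.
Qed.

Lemma all_cubicsP F : reflect (exists2 i, i \in incr6 n &
    exists2 D, D \in cubic_table & F = cubic i D) (F \in all_cubics k n).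
Proof.
rewrite all_cubicsE; apply: (iffP idP) => [/allpairsP[[i D] /= [iin DT ->]]|].
  by exists i; [rewrite mem_enum in iin | exists D].
by case=> i iin [D DT ->]; apply/allpairsP; exists (i, D); rewrite /= mem_enum.
Qed.

Lemma uniq_all_cubics : uniq (all_cubics k n).
Proof.
rewrite all_cubicsE; apply: allpairs_uniq => //; first exact: enum_uniq.
move=> [i D] [j D'] /allpairsPdep[i1 [D1 [Hi HD [-> ->]]]].
move=> /allpairsPdep[j1 [D1' [Hj HD' [-> ->]]]] /= e.
rewrite !mem_enum in Hi Hj.
have := mcoeff_cubic_lead Hi Hi HD HD; rewrite e mcoeff_cubic_lead // !eqxx /=.
case: eqP => [->|_]; case: eqP => [->|_] //= /eqP; by rewrite eq_sym oner_eq0.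
Qed.

Lemma cubic_homog i D : D \in cubic_table -> cubic i D \is 3.-homog.
Proof.
move=> HD; rewrite /cubic big_seq; apply: rpred_sum => t tD; apply: rpredZ.
rewrite dhomogX /= /matching_mnm mdeg_sum.
rewrite (eq_bigr (fun=> 1%N)) => [|e _]; last exact: mdeg1.
by rewrite sum1_size; have [_ -> _] := perfectP (mem_matchings HD tD).
Qed.

End Cubics.

(** * The cubics in the apolar ideal *)

(** The ways to direct all the edges of a matching, each given by its tails (the
    rows to delete) and its heads (the columns to delete). *)
Fixpoint orientations (mu : matching) : seq (seq nat * seq nat) :=
  if mu is e :: mu' then
    flatten [seq [:: (e.1 :: o.1, e.2 :: o.2); (e.2 :: o.1, e.1 :: o.2)]
            | o <- orientations mu']
  else [:: ([::], [::])].

Definition complement6 (A : seq nat) : seq nat := [seq x <- iota 1 6 | x \notin A].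

(** The tails of an orientation of a perfect matching form a set that meets each
    edge once, and they determine the heads. Sorting gives one list for each
    set. *)
Definition splits (mu : matching) : seq (seq nat) :=
  [seq sort leq o.1 | o <- orientations mu].

Definition signed_splits (b : bool) (D : seq (bool * matching)) : seq (seq nat) :=
  flatten [seq splits t.2 | t <- D & t.1 == b].

Lemma orientations_split : all (fun mu => all (fun o =>
  [&& uniq o.1, uniq o.2, all [in iota 1 6] o.1, all [in iota 1 6] o.2
    & perm_eq o.2 (complement6 (sort leq o.1))]) (orientations mu)) matchings.
Proof. by vm_compute. Qed.

(** Each 3-subset of 1, ..., 6 meets every edge once for as many matchings of sign
    1 as of sign -1, in each of the five cubics. *)
Lemma cubic_table_balanced : all (fun D =>
  perm_eq (signed_splits false D) (signed_splits true D)) cubic_table.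
Proof. by vm_compute. Qed.

Lemma orientations_sub mu o : o \in orientations mu -> {subset o.1 <= endpoints mu}.
Proof.
elim: mu o => [|e mu IH] o /=; first by rewrite inE => /eqP -> .
move=> /flatten_mapP[o' /IH sub]; rewrite !inE => /orP[]/eqP -> x /=.
  by rewrite !inE => /orP[->//|/sub ->]; rewrite !orbT.
by rewrite !inE => /orP[->|/sub ->]; rewrite !orbT.
Qed.

Section Annihilation.
Variables (k : fieldType) (n : nat).
Implicit Types (i : {ffun 'I_6 -> 'I_n}) (mu : matching).

Notation perm_poly := (permanent (generic_symmx k n)).

(** Each edge contributes the two terms of [partial_minor], one for each of its
    directions. *)
Lemma matching_action i mu : uniq (map (vertex i) (endpoints mu)) ->
  diff_act 'X_[matching_mnm i mu] perm_poly =
  \sum_(o <- orientations mu) minor k (map (vertex i) o.1) (map (vertex i) o.2).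
Proof.
elim: mu => [_|e mu IH] /=.
  by rewrite big_seq1 /matching_mnm big_nil diff_actX mderivm0m permanent_minor.
rewrite inE negb_or -!andbA => /and4P[e12 e1 e2 /IH {}IH].
rewrite /matching_mnm big_cons mpolyXD diff_actM -/(matching_mnm i mu) IH.
rewrite big_flatten big_map -/(symvar k _ _) raddf_sum big_seq [RHS]big_seq.
apply: eq_bigr => o /orientations_sub sub /=.
have fresh x : vertex i x \notin map (vertex i) (endpoints mu) ->
    vertex i x \notin map (vertex i) o.1.
  by apply: contra => /mapP[y yo ->]; apply: map_f; apply: sub.
by rewrite !big_cons big_nil addr0 diff_symvar partial_minor ?fresh.
Qed.

Definition split_minor i (A : seq nat) : sympoly k n :=
  minor k (map (vertex i) A) (map (vertex i) (complement6 A)).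

(** A minor depends only on the sets of deleted rows and columns, so each
    orientation is represented by its set of tails. *)
Lemma matching_action_splits i mu : i \in incr6 n -> mu \in matchings ->
  diff_act 'X_[matching_mnm i mu] perm_poly = \sum_(A <- splits mu) split_minor i A.
Proof.
move=> Hi Hmu; have vinj := vertex_inj Hi.
have uv s : uniq s -> all [in iota 1 6] s -> uniq (map (vertex i) s).
  move=> us /allP sub; rewrite map_inj_in_uniq // => x y /sub xs /sub ys.
  exact: vinj.
have [p _ _] := perfectP Hmu.
rewrite matching_action; last first.
  apply: uv; first by rewrite (perm_uniq p) iota_uniq.
  by rewrite (perm_all _ p); apply/allP.
rewrite big_map big_seq [RHS]big_seq; apply: eq_bigr => o oin.
have /and5P[u1 u2 s1 s2 pc] := allP (allP orientations_split _ Hmu) _ oin.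
apply: minor_perm; rewrite ?uv //; last exact: perm_map.
by apply: perm_map; rewrite perm_sym perm_sort.
Qed.

Lemma cubic_annihilates i D : i \in incr6 n -> D \in cubic_table ->
  diff_act (cubic k i D) perm_poly = 0.
Proof.
move=> Hi HD; rewrite /cubic diff_act_suml.
transitivity (\sum_(t <- D) (-1) ^+ t.1 *: \sum_(A <- splits t.2) split_minor i A).
  rewrite !big_seq; apply: eq_bigr => t tD.
  by rewrite diff_actZl matching_action_splits // (mem_matchings HD tD).
have signed b : \sum_(t <- D | t.1 == b) \sum_(A <- splits t.2) split_minor i A =
    \sum_(A <- signed_splits b D) split_minor i A.
  by rewrite big_flatten big_map big_filter.
rewrite (bigID (fun t => t.1 == false)) /=.
rewrite (eq_bigr (fun t => \sum_(A <- splits t.2) split_minor i A)); last first.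
  by move=> t /eqP ->; rewrite expr0 scale1r.
rewrite signed (perm_big _ (allP cubic_table_balanced _ HD)) -signed.
rewrite -[X in X + _]opprK -sumrN; apply/eqP; rewrite addrC subr_eq0; apply/eqP.
apply: eq_big => [t|t]; first by case: t.1.
by case: t.1 => // _; rewrite expr1 scaleN1r.
Qed.

Hypothesis two_neq0 : (2%:R : k) != 0.

Lemma lepm_subU (N : nat) (m M : 'X_{1..N}) (v : 'I_N) :
  (m <= M)%MM -> (m v < M v)%N -> (m <= M - U_(v))%MM.
Proof.
move=> /mnm_lepP le lt; apply/mnm_lepP => w; rewrite mnmBE mnm1E.
have [<-|_] := eqVneq v w; last by rewrite subn0.
by rewrite leq_subRL ?(leq_ltn_trans _ lt) // add1n.
Qed.

(** A proper divisor of a matching monomial misses one of the three edges, hence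
    divides the product of the two others, where [Ann_coef_quadric] applies. *)
Lemma Ann_coef_below_matching i mu h m : i \in incr6 n -> mu \in matchings ->
  h \in Ann perm_poly -> (m <= matching_mnm i mu)%MM -> m != matching_mnm i mu ->
  h@_m = 0.
Proof.
move=> Hi Hmu hA le ne; set M := matching_mnm i mu in le ne *.
have [v lt] : exists v, (m v < M v)%N.
  apply/existsP; apply: contraNT ne => /existsPn ge; apply/eqP/mnmP => v.
  by apply/eqP; rewrite eqn_leq (mnm_lepP le) leqNgt ge.
have {le} := lepm_subU le lt.
have [p sz _] := perfectP Hmu.
have u : uniq (map (vertex i) (endpoints mu)).
  rewrite map_inj_in_uniq; first by rewrite (perm_uniq p) iota_uniq.
  by move=> x y; rewrite !(perm_mem p); apply: vertex_inj.
have vM : (0 < M v)%N by apply: leq_ltn_trans lt.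
move: sz p u vM lt; rewrite /M; case: mu {Hmu ne M} => [|e1 [|e2 [|e3 [|]]]] //= _ _ u.
rewrite matching_mnmE -has_count /= orbF => v123 _.
have u6 : uniq [:: vertex i e1.1; vertex i e1.2; vertex i e2.1; vertex i e2.2;
  vertex i e3.1; vertex i e3.2] by [].
rewrite /matching_mnm !big_cons big_nil addm0.
case/or3P: v123 => /eqP <-.
- rewrite addmC addmK; apply: (Ann_coef_quadric two_neq0) => //.
  exact: (mask_uniq u6 [:: false; false; true; true; true; true]).
- rewrite [(U_(edge i e2) + _)%MM]addmC addmA addmK.
  apply: (Ann_coef_quadric two_neq0) => //.
  exact: (mask_uniq u6 [:: true; true; false; false; true; true]).
- rewrite addmA addmK; apply: (Ann_coef_quadric two_neq0) => //.
  exact: (mask_uniq u6 [:: true; true; true; true; false; false]).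
Qed.

End Annihilation.

Theorem lemma3p18 (k : fieldType) (n : nat)
    (k_infinite : infinite_field k)
    (k_char : [pchar k] =i pred0 \/ (exists2 p : nat, p \in [pchar k] & (2 < p)%N)) :
  [/\ uniq (all_cubics k n),
      size (all_cubics k n) = (5 * 'C(n, 6))%N,
      {in all_cubics k n, forall F, F \is 3.-homog},
      {in all_cubics k n, forall F,
        diff_act F (permanent (generic_symmx k n)) = 0}
    & exists2 G : seq (sympoly k n),
        minimal_homog_generators (Ann (permanent (generic_symmx k n))) G
        & {subset all_cubics k n <= G}].
Proof.
have two_neq0 : (2%:R : k) != 0.
  apply/negP => two0; have char2 : 2%N \in [pchar k] by rewrite inE.
  case: k_char => [char0|[p charp lt2p]]; first by have := char0 2%N; rewrite char2.
  by have := pcharf_eq charp 2%N; rewrite char2 inE => /esym/eqP e; rewrite -e in lt2p.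
have degree3 : {in all_cubics k n, forall F, F \is 3.-homog}.
  by move=> F /all_cubicsP[i _ [D DT ->]]; apply: cubic_homog.
have annihilates : {in all_cubics k n, forall F,
    diff_act F (permanent (generic_symmx k n)) = 0}.
  by move=> F /all_cubicsP[i Hi [D DT ->]]; apply: cubic_annihilates.
split=> //; [exact: uniq_all_cubics|exact: size_all_cubics|].
have homog_perm : permanent (generic_symmx k n) \is n.-homog.
  apply: rpred_sum => s _.
  have : \prod_(i < n) generic_symmx k n i (s i) \is (\sum_(i < n) 1%N).-homog.
    elim/big_rec2: _ => [|i d p _ IH]; first exact: dhomog1.
    by rewrite mxE; apply: dhomogM => //; rewrite dhomogX /= mdeg1.
  by rewrite sum1_card card_ord.
have [G0 genG0 homG0] := Ann_homog_finitely_generated homog_perm.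
apply: (extend_to_minimal_generators genG0 homG0).
- by move=> F /degree3; exists 3.
- by move=> F /annihilates FA; apply/AnnP.
move=> F /all_cubicsP[i Hi [D DT ->]]; exists (matching_mnm i (lead D)).
have leadD := lead_matchings DT.
split=> [|F' /all_cubicsP[j Hj [D' DT' ->]]|h m hA].
- by rewrite mcoeff_cubic_lead // !eqxx oner_eq0.
- move=> ne; rewrite mcoeff_cubic_lead //; have [ji|//] := eqVneq j i.
  have [DD|//] := eqVneq D' D; by rewrite ji DD eqxx in ne.
- exact: Ann_coef_below_matching.
Qed.
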